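(* Let $(D,\sigma)$ be a signed digraph and let $\eta:V(D)\to\{+1,-1\}$. Define the switched signing by \[ \sigma^\eta(ij)=\eta(i)\,\sigma(ij)\,\eta(j) \] for every arrow $i\to j$. Then \[ H_p^\sigma(D)\cong H_p^{\sigma^\eta}(D) \] for every $p\ge 0$.
   Context: Signed digraphs. A signed digraph is a pair $(D,\sigma)$ where $D=(V,A)$ is a finite loopless digraph with at most one arrow from $i$ to $j$ for each ordered pair $(i,j)$, and $\sigma:A\to\{+1,-1\}$ is any function (antiparallel arrows are allowed and may have different signs). Write $\sigma(ij)$ for the sign of $i\to j$. Signed double cover. $\widetilde D_\sigma$ is the digraph with vertices $i^\varepsilon=(i,\varepsilon)\in V\times\{+1,-1\}$ and arrows $i^\varepsilon\to j^{\varepsilon\sigma(ij)}$ for each arrow $i\to j$ of $D$ and each $\varepsilon$. The deck involution is $\tau(i^\varepsilon)=i^{-\varepsilon}$, acting on paths vertexwise. Signed GLMY homology (over $\mathbb R$). A $p$-path on $V\times\{+1,-1\}$ is a sequence of $p+1$ lifted vertices; it is regular if consecutive lifted vertices are distinct (so $u^+u^-$ is regular, $u^+u^+$ is not) and allowed if consecutive lifted vertices are joined by arrows of $\widetilde D_\sigma$. $\mathcal R_p(\widetilde D_\sigma)$ is the real vector space with basis $e_{\widetilde\gamma}$, $\widetilde\gamma$ a regular $p$-path (no arrow condition), with boundary $e_{v_0\cdots v_p}\mapsto\sum_{q=0}^p(-1)^qe_{v_0\cdots\widehat{v_q}\cdots v_p}$ for $p\ge1$ (nonregular terms are zero), and zero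 boundary for $p=0$. $R_p^\sigma(D)$ is the quotient of $\mathcal R_p(\widetilde D_\sigma)$ by the span of all $e_{\tau\widetilde\gamma}+e_{\widetilde\gamma}$; $[e_{\widetilde\gamma}]$ is the class of $e_{\widetilde\gamma}$. The boundary commutes with $\tau$ and induces $\partial^\sigma_{\mathrm{reg},p}:R_p^\sigma(D)\to R_{p-1}^\sigma(D)$ (zero for $p=0$, with $R^\sigma_{-1}=0$). $\mathcal A_p^\sigma(D)\subseteq R_p^\sigma(D)$ is the span of the classes of allowed paths. Set $\Omega_0^\sigma(D)=\mathcal A_0^\sigma(D)$, $\Omega_p^\sigma(D)=\{z\in\mathcal A_p^\sigma(D):\partial^\sigma_{\mathrm{reg},p}z\in\mathcal A^\sigma_{p-1}(D)\}$ for $p\ge1$, $\Omega_{-1}^\sigma(D)=0$, and let $\partial_p^\sigma:\Omega_p^\sigma(D)\to\Omega_{p-1}^\sigma(D)$ be the restriction of $\partial^\sigma_{\mathrm{reg},p}$. $H_p^\sigma(D)$, $p\ge0$, is the homology of the chain complex $(\Omega_\bullet^\sigma(D),\partial_*^\sigma)$. *)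

(* Defs.v *)
From HB Require Import structures.
From mathcomp Require Import all_boot all_order all_algebra.
From mathcomp Require Import reals zify.

Set Implicit Arguments.
Unset Strict Implicit.
Unset Printing Implicit Defensive.

Import GRing.Theory Quotient VectorInternalTheory.
Local Open Scope ring_scope.
Local Open Scope quotient_scope.

Section VectorQuotient.
Variables (K : fieldType) (V : vectType K) (W : {vspace V}).

Definition vquot := {quot W}.
HB.instance Definition _ := GRing.Zmodule.on vquot.

Definition vcls (v : V) : vquot := \pi_{quot W} v.
Definition vrep (x : vquot) : V := @repr _ {quot W} x.

Lemma vrepK : cancel vrep vcls.
Proof. exact: (@reprK _ {quot W}). Qed.

Lemma vcls_eq (u v : V) : (vcls u == vcls v) = (u - v \in W).
Proof. by rewrite (idealrBE W u v). Qed.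

Lemma vclsD : {morph vcls : u v / u + v}.
Proof. by move=> u v; exact: (pi_add W u v). Qed.

Lemma vrep_cls (v : V) : vrep (vcls v) - v \in W.
Proof. by rewrite -vcls_eq vrepK. Qed.

Definition vquot_scale (a : K) (x : vquot) : vquot := vcls (a *: vrep x).

Lemma vclsZ a : {morph vcls : v / a *: v >-> vquot_scale a v}.
Proof.
move=> v; apply/eqP; rewrite eq_sym vcls_eq -scalerBr.
by rewrite rpredZ ?vrep_cls.
Qed.

Fact vquot_scaleA a b x :
  vquot_scale a (vquot_scale b x) = vquot_scale (a * b) x.
Proof. by rewrite -[x]vrepK -!vclsZ scalerA. Qed.

Fact vquot_scale1 : left_id 1 vquot_scale.
Proof. by move=> x; rewrite -[x]vrepK -!vclsZ scale1r. Qed.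

Fact vquot_scaleDr : right_distributive vquot_scale +%R.
Proof.
move=> a x y; rewrite -[x]vrepK -[y]vrepK.
by rewrite -vclsD -!vclsZ scalerDr vclsD.
Qed.

Fact vquot_scaleDl x : {morph vquot_scale^~ x : a b / a + b}.
Proof. by move=> a b; rewrite -[x]vrepK -!vclsZ scalerDl vclsD. Qed.

HB.instance Definition _ := GRing.Zmodule_isLmodule.Build K vquot
  vquot_scaleA vquot_scale1 vquot_scaleDr vquot_scaleDl.

Fact vcls_linear : linear vcls.
Proof. by move=> a u v; rewrite vclsD vclsZ. Qed.
HB.instance Definition _ := GRing.isSemilinear.Build K V vquot _ vcls
  (GRing.semilinear_linear vcls_linear).

Lemma vcls_eq0 (v : V) : (vcls v == 0) = (v \in W).
Proof. by rewrite -(raddf0 vcls) vcls_eq subr0. Qed.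

Let compl (v : V) : subvs_of W^C := Subvs (memv_projC W v).

Let compl_linear : linear compl.
Proof.
by move=> a u v; apply: val_inj; rewrite /= linearP scalerBr opprD addrACA.
Qed.

Let compl_cls (v : V) : compl (vrep (vcls v)) = compl v.
Proof.
rewrite -[vrep _](subrK v) -[_ - v]scale1r compl_linear scale1r.
rewrite -[RHS]add0r; congr (_ + _); apply: val_inj => /=.
by rewrite projv_id ?subrr ?vrep_cls.
Qed.

Fact vquot_vect_iso : Vector.axiom (dim (subvs_of W^C)) vquot.
Proof.
exists (fun x => v2r (compl (vrep x))).
  move=> a x y; rewrite -[x]vrepK -[y]vrepK -linearP !compl_cls.
  by rewrite compl_linear linearP.
exists (fun r => vcls (vsval (r2v r : subvs_of W^C))) => [x|r].
  rewrite v2rK /= -[RHS]vrepK; apply/eqP; rewrite vcls_eq.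
  by rewrite addrAC subrr add0r rpredN memv_proj.
rewrite compl_cls -[RHS]r2vK; congr v2r; apply: val_inj => /=.
have : vsval (r2v r : subvs_of W^C) \in lker (projv W).
  by rewrite lker_proj subvsP.
by rewrite memv_ker => /eqP->; rewrite subr0.
Qed.

HB.instance Definition _ := Lmodule_hasFinDim.Build K vquot vquot_vect_iso.
End VectorQuotient.

Section QuotientMap.
Variables (K : fieldType) (U V : vectType K).
Variables (WU : {vspace U}) (WV : {vspace V}).

(* The map induced by f on the quotients; meaningful when f sends WU into WV, *)
(* cf. vquot_homE.                                                            *)
Definition vquot_hom (f : 'Hom(U, V)) : 'Hom(vquot WU, vquot WV) :=
  linfun (fun x : vquot WU => vcls WV (f (vrep x))).

Lemma vquot_homE (f : 'Hom(U, V)) (u : U) :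
  (f @: WU <= WV)%VS -> vquot_hom f (vcls WU u) = vcls WV (f u).
Proof.
move=> fW; have fE v : vcls WV (f (vrep (vcls WU v))) = vcls WV (f v).
  apply/eqP; rewrite vcls_eq -linearB; apply: (subvP fW).
  by rewrite memv_img ?vrep_cls.
have lin : linear (fun x : vquot WU => vcls WV (f (vrep x))).
  move=> a x y; rewrite -[x]vrepK -[y]vrepK -linearP !fE.
  by rewrite !linearP.
pose g := GRing.isSemilinear.Build K _ _ _ _ (GRing.semilinear_linear lin).
pose G : {linear vquot WU -> vquot WV} :=
  HB.pack (fun x : vquot WU => vcls WV (f (vrep x))) g.
by rewrite /vquot_hom (lfunE G) /= fE.
Qed.
End QuotientMap.

(* The group {+1, -1} is rendered as bool: the boolean b stands for (-1) ^+ b *)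
(* (so true is -1), and the product of signs is the exclusive or (+).         *)
Notation sign := bool (only parsing).

Record digraph := Digraph {
  vertex : finType;
  arrow : {set vertex * vertex};
  arrow_loopless : forall i, (i, i) \notin arrow
}.

Definition signing (D : digraph) :=
  {a : vertex D * vertex D | a \in arrow D} -> sign.

Definition switch (D : digraph) (eta : vertex D -> sign) (sigma : signing D) :
    signing D :=
  fun a => eta (val a).1 (+) sigma a (+) eta (val a).2.

Section SignedHomology.
Variables (R : realType) (D : digraph).

Definition lvertex := (vertex D * sign)%type.

Definition larrow (sigma : signing D) : rel lvertex := fun u v =>
  [exists a : {a : vertex D * vertex D | a \in arrow D},
    (val a == (u.1, v.1)) && (v.2 == u.2 (+) sigma a)].

Definition deck (u : lvertex) : lvertex := (u.1, ~~ u.2).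

Definition regular : pred (seq lvertex) := sorted (fun u v => u != v).
Definition allowed (sigma : signing D) : pred (seq lvertex) :=
  sorted (larrow sigma).

Lemma allowed_regular sigma t : allowed sigma t -> regular t.
Proof.
apply: sub_sorted => u v /existsP[a /andP[/eqP av _]].
apply/eqP => uv; have := valP a.
by rewrite av uv (negPf (arrow_loopless _)).
Qed.

Section Degree.
Variable p : nat.

Definition regular_path := {t : p.+1.-tuple lvertex | regular t}.

Definition chain : vectType R := {ffun regular_path -> R^o}.

(* Defined for every p-path; it vanishes when t is not regular. *)
Definition path_chain (t : p.+1.-tuple lvertex) : chain :=
  [ffun g => (val g == t)%:R].

Definition deck_path (t : p.+1.-tuple lvertex) : p.+1.-tuple lvertex :=
  map_tuple deck t.

Definition deck_relations : {vspace chain} :=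
  <<[seq (path_chain (deck_path (val g)) + path_chain (val g))%R
      | g : regular_path]>>%VS.

Definition signed_chain : vectType R := vquot deck_relations.

Definition path_class (t : p.+1.-tuple lvertex) : signed_chain :=
  vcls deck_relations (path_chain t).

Definition allowed_chain (sigma : signing D) : {vspace signed_chain} :=
  <<[seq path_class t | t : p.+1.-tuple lvertex in
      [pred t : p.+1.-tuple lvertex | allowed sigma t]]>>%VS.

End Degree.

Definition face p (q : 'I_p.+2) (t : p.+2.-tuple lvertex) :
    p.+1.-tuple lvertex :=
  [tuple tnth t (lift q i) | i < p.+1].

Definition path_boundary p (t : p.+2.-tuple lvertex) : chain p :=
  \sum_(q < p.+2) (-1) ^+ q *: path_chain (face q t).

Definition chain_boundary p : 'Hom(chain p.+1, chain p) :=
  linfun (fun x : chain p.+1 =>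
    \sum_(g : regular_path p.+1) x g *: path_boundary (val g)).

Lemma chain_boundary_path p (g : regular_path p.+1) :
  chain_boundary p (path_chain (val g)) = path_boundary (val g).
Proof.
have lin : linear (fun x : chain p.+1 =>
    \sum_(g : regular_path p.+1) x g *: path_boundary (val g)).
  move=> a x y; rewrite scaler_sumr -big_split /=; apply: eq_bigr => h _.
  by rewrite !ffunE scalerDl scalerA.
pose b := GRing.isSemilinear.Build R _ _ _ _ (GRing.semilinear_linear lin).
pose B : {linear chain p.+1 -> chain p} := HB.pack (fun x : chain p.+1 =>
    \sum_(g : regular_path p.+1) x g *: path_boundary (val g)) b.
rewrite /chain_boundary (lfunE B) /= (bigD1 g) //= ffunE eqxx scale1r.
rewrite big1 ?addr0 // => h hg.
by rewrite ffunE (inj_eq val_inj) (negPf hg) scale0r.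
Qed.

Lemma deckK : involutive deck.
Proof. by case=> i e; rewrite /deck /= negbK. Qed.

Lemma regular_deck p (t : p.+1.-tuple lvertex) :
  regular (deck_path t) = regular t.
Proof.
rewrite /regular /= sorted_map; case: (val t) => //= x s.
by apply: eq_path => u v /=; rewrite (inj_eq (inv_inj deckK)).
Qed.

Lemma face_deck p (q : 'I_p.+2) (t : p.+2.-tuple lvertex) :
  face q (deck_path t) = deck_path (face q t).
Proof.
apply: eq_from_tnth => i.
by rewrite !(tnth_map, tnth_mktuple, tnth_ord_tuple).
Qed.

Lemma path_chain_nonregular p (t : p.+1.-tuple lvertex) :
  ~~ regular t -> path_chain t = 0.
Proof.
move=> nt; apply/ffunP=> g; rewrite !ffunE.
by case: eqP => // gt; case/negP: nt; rewrite -gt; exact: valP g.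
Qed.

Lemma chain_boundary_deck p :
  (chain_boundary p @: deck_relations p.+1 <= deck_relations p)%VS.
Proof.
rewrite /deck_relations limg_span; apply/span_subvP => y.
case/mapP=> _ /imageP[g _ ->] ->; rewrite linearD /=.
have rg : regular (deck_path (val g)) by rewrite regular_deck; exact: valP g.
pose dg : regular_path p.+1 := exist _ (deck_path (val g)) rg.
rewrite (chain_boundary_path dg) chain_boundary_path -big_split /=.
apply: rpred_sum => q _; rewrite -scalerDr rpredZ // face_deck.
have [rf|nf] := boolP (regular (face q (val g))).
  pose h : regular_path p := exist _ (face q (val g)) rf.
  by apply: memv_span; apply/imageP; exists h.
by rewrite !path_chain_nonregular ?regular_deck // addr0 rpred0.
Qed.

Definition signed_boundary p : 'Hom(signed_chain p.+1, signed_chain p) :=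
  vquot_hom (deck_relations p.+1) (deck_relations p) (chain_boundary p).

Lemma nth_face p (q : 'I_p.+2) (t : p.+2.-tuple lvertex) u0 i :
  (i < p.+1)%N -> nth u0 (face q t) i = nth u0 t (bump q i).
Proof.
move=> ip; rewrite -[i]/(val (Ordinal ip)) -tnth_nth tnth_mktuple.
by rewrite (tnth_nth u0).
Qed.

Lemma regularP p (t : p.+1.-tuple lvertex) u0 :
  reflect (forall i, (i < p)%N -> nth u0 t i != nth u0 t i.+1) (regular t).
Proof.
apply: (iffP (sortedP u0)) => h i.
  by move=> ip; apply: h; rewrite size_tuple.
by rewrite size_tuple; apply: h.
Qed.

Lemma chain_boundary_pathE p (t : p.+2.-tuple lvertex) :
  chain_boundary p (path_chain t) = path_boundary t.
Proof.
have [rt|nt] := boolP (regular t).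
  pose h : regular_path p.+1 := exist _ t rt.
  exact: (chain_boundary_path h).
rewrite path_chain_nonregular // linear0; apply/esym.
pose u0 := tnth t ord0.
have /existsP[i] : [exists i : 'I_p.+1, nth u0 t i == nth u0 t i.+1].
  apply: contraNT nt; rewrite negb_exists => /forallP h.
  by apply/(regularP t u0) => i ip; exact: (h (Ordinal ip)).
move=> /eqP ti; pose a : 'I_p.+2 := widen_ord (leqnSn _) i.
pose b : 'I_p.+2 := lift ord0 i.
have ab : b != a by rewrite -val_eqE /= /bump /=; lia.
rewrite /path_boundary (bigD1 a) //= (bigD1 b) //= big1 => [|q /andP[qa qb]].
  rewrite addr0 (_ : face b t = face a t).
    by rewrite -scalerDl /b /= /bump /= exprS mulN1r subrr scale0r.
  apply/val_inj/(@eq_from_nth _ u0); rewrite ?size_tuple // => j jp.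
  rewrite !nth_face //= /bump /=.
  have [->|ji] := eqVneq j i.
    by rewrite leqnn add1n ltnn add0n.
  by congr (nth u0 t _); congr (_ + _)%N; lia.
rewrite path_chain_nonregular ?scaler0 //; apply/negP => /(regularP _ u0) h.
have := ltn_ord i; have := ltn_ord q; move: qa qb.
rewrite -!val_eqE /= /bump /= => qa qb qp ip.
have [qi|iq] := ltnP q i.
  have /h : (i.-1 < p)%N by lia.
  rewrite !nth_face; try lia.
  have -> : bump q i.-1 = i by rewrite /bump; lia.
  have -> : bump q i.-1.+1 = i.+1 by rewrite /bump; lia.
  by rewrite ti eqxx.
have /h : (i < p)%N by lia.
rewrite !nth_face; try lia.
have -> : bump q i = i by rewrite /bump; lia.
have -> : bump q i.+1 = i.+1 by rewrite /bump; lia.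
by rewrite ti eqxx.
Qed.

Lemma face_face p (q : 'I_p.+3) (r : 'I_p.+2) (q' : 'I_p.+2) (r' : 'I_p.+3)
    (t : p.+3.-tuple lvertex) :
  (r < q)%N -> q' = q.-1 :> nat -> r' = r :> nat ->
  face r (face q t) = face q' (face r' t).
Proof.
move=> rq q'E r'E; pose u0 := tnth t ord0.
apply/val_inj/(@eq_from_nth _ u0); rewrite ?size_tuple // => j jp.
have := ltn_ord q => qp.
rewrite !nth_face //; try by rewrite /bump; lia.
by rewrite q'E r'E; congr nth; rewrite /bump; lia.
Qed.

Lemma chain_boundaryK p (x : chain p.+2) :
  chain_boundary p (chain_boundary p.+1 x) = 0.
Proof.
have xE : x = \sum_(g : regular_path p.+2) x g *: path_chain (val g).
  apply/ffunP => h; rewrite sum_ffunE (bigD1 h) //= big1 => [|g gh].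
    by rewrite !ffunE eqxx addr0 [_ *: _]mulr1.
  by rewrite !ffunE (inj_eq val_inj) eq_sym (negPf gh) scaler0.
rewrite xE !linear_sum big1 //= => g _; rewrite !linearZ /=.
apply/eqP; rewrite scaler_eq0; apply/orP; right; apply/eqP.
rewrite chain_boundary_pathE linear_sum /=.
under eq_bigr => q _ do
  rewrite linearZ /= chain_boundary_pathE /path_boundary scaler_sumr.
rewrite pair_big /= (bigID (fun i : 'I_p.+3 * 'I_p.+2 => (i.2 < i.1)%N)) /=.
apply/eqP; rewrite addr_eq0; apply/eqP.
pose f (i : 'I_p.+3 * 'I_p.+2) : 'I_p.+3 * 'I_p.+2 :=
  (inord i.2, inord i.1.-1).
pose f' (i : 'I_p.+3 * 'I_p.+2) : 'I_p.+3 * 'I_p.+2 :=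
  (inord i.2.+1, inord i.1).
rewrite (reindex_onto f' f) /=; last first.
  move=> [q r] /= rq; have := ltn_ord q; have := ltn_ord r => rp qp.
  by congr pair; apply/val_inj; rewrite /= !inordK ?prednK //; lia.
rewrite -sumrN; apply: eq_big => [[q r]|[q r] /andP[]] /=.
  have := ltn_ord q; have := ltn_ord r => rp qp.
  have r1E : (inord r.+1 : 'I_p.+3) = r.+1 :> nat by rewrite inordK; lia.
  have [rq|qr] := ltnP r q; apply/andP.
    case=> qr1 /eqP[] /(congr1 val) /= qE _; move: qr1 qE; rewrite r1E.
    case: (inord q) => m /= mp mr; rewrite inordK; lia.
  have qE : (inord q : 'I_p.+2) = q :> nat by rewrite inordK; lia.
  split; first by rewrite r1E qE; lia.
  rewrite /f /f' /=; apply/eqP; congr pair; apply/val_inj.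
    by rewrite /= qE inordK; lia.
  by rewrite /= r1E /= inordK; lia.
move=> qr1 /eqP[] /(congr1 val) /= qE _.
have := ltn_ord q; have := ltn_ord r => rp qp.
have r1E : (inord r.+1 : 'I_p.+3) = r.+1 :> nat by rewrite inordK; lia.
have qqE : (inord q : 'I_p.+2) = q :> nat.
  by move: qE; rewrite inordK; have := ltn_ord (inord q : 'I_p.+2); lia.
rewrite (@face_face _ _ _ r q) ?r1E ?qqE //; last by rewrite -qqE -r1E.
by rewrite !scalerA exprS mulN1r mulNr scaleNr mulrC.
Qed.

Lemma signed_boundaryK p : (signed_boundary p \o signed_boundary p.+1)%VF = 0.
Proof.
apply/lfunP => x; rewrite lfunE /= lfunE -[x]vrepK.
rewrite !vquot_homE ?chain_boundary_deck //.
by rewrite chain_boundaryK linear0.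
Qed.

Variable sigma : signing D.

Definition Omega p : {vspace signed_chain p} :=
  match p with
  | 0 => allowed_chain 0 sigma
  | q.+1 =>
    (allowed_chain q.+1 sigma
      :&: signed_boundary q @^-1: allowed_chain q sigma)%VS
  end.

Definition cycles p : {vspace signed_chain p} :=
  match p with
  | 0 => Omega 0
  | q.+1 => (Omega q.+1 :&: lker (signed_boundary q))%VS
  end.

Definition boundaries p : {vspace signed_chain p} :=
  (signed_boundary p @: Omega p.+1)%VS.

Lemma boundaries_sub_cycles p : (boundaries p <= cycles p)%VS.
Proof.
rewrite /boundaries; case: p => [|q].
  by apply/subvP => _ /memv_imgP[z /memv_capP[_ zA] ->]; rewrite memv_preim.
apply/subvP => _ /memv_imgP[z /memv_capP[_ zA] ->] /=.
have zz : signed_boundary q (signed_boundary q.+1 z) = 0.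
  by have /lfunP/(_ z) := signed_boundaryK q; rewrite !lfunE.
rewrite !memv_cap memv_ker -!memv_preim zz rpred0 eqxx !andbT.
by rewrite memv_preim.
Qed.

(* The boundaries are pulled back to the type of cycles, of which they form a *)
(* subspace by boundaries_sub_cycles.                                         *)
Definition homology p : vectType R :=
  vquot (linfun (vsval : subvs_of (cycles p) -> _) @^-1: boundaries p)%VS.

End SignedHomology.

(* Main.v *)
(* The relabelling [(i, e) |-> (i, e (+) eta i)] of the lifted vertices is an *)
(* involution commuting with the deck transformation, and it identifies the   *)
(* double cover of [sigma] with that of [switch eta sigma].  It therefore     *)
(* acts on signed chains, commutes with the boundary and exchanges the        *)
(* allowed chains of both signings, hence their cycles and boundaries.        *)

Require Import Defs.
From HB Require Import structures.
From mathcomp Require Import all_boot all_order all_algebra.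
From mathcomp Require Import reals.

Import GRing.Theory.
Local Open Scope ring_scope.

(** Regular signed chains and their boundary depend on the vertices of [D] only; the signing enters
    through the allowed paths. Switching is therefore realised by a single involutive automorphism
    [relabel_signed] of the ambient complex. By [larrow_relabel] it matches the allowed paths of
    both signings, and since it commutes with the boundary, membership transfers from allowed chains
    to [Omega], cycles and boundaries. Finally [vquot_preim_iso] passes from an ambient bijection
    matching cycles and boundaries to an isomorphism of the quotients. *)

Lemma vquot_preim_iso (K : fieldType) (U V : vectType K)
    (f : 'Hom(U, V)) (g : V -> U) (Z B : {vspace U}) (Z' B' : {vspace V}) :
    cancel f g -> cancel g f ->
    (forall u, (f u \in Z') = (u \in Z)) ->
    (forall u, (f u \in B') = (u \in B)) ->
  exists h : {linear
      vquot (linfun (vsval : subvs_of Z -> U) @^-1: B)%VS ->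
      vquot (linfun (vsval : subvs_of Z' -> V) @^-1: B')%VS},
    bijective h.
Proof.
move=> fK gK fZ fB.
set W := (_ @^-1: B)%VS; set W' := (_ @^-1: B')%VS.
have memW x : (x \in W) = (vsval x \in B) by rewrite -memv_preim lfunE.
have memW' x : (x \in W') = (vsval x \in B') by rewrite -memv_preim lfunE.
pose F : 'Hom(subvs_of Z, subvs_of Z') :=
  linfun (vsproj Z' \o (f \o (vsval : subvs_of Z -> U))).
have FE x : vsval (F x) = f (vsval x).
  by rewrite lfunE /= vsprojK // fZ subvsP.
have FW x : (F x \in W') = (x \in W) by rewrite memW memW' FE fB.
have FWW : (F @: W <= W')%VS.
  by apply/subvP => _ /memv_imgP[x xW ->]; rewrite FW.
pose G (y : subvs_of Z') : subvs_of Z := vsproj Z (g (vsval y)).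
have GK : cancel G F.
  move=> y; apply: val_inj; rewrite /= FE vsprojK ?gK //.
  by rewrite -fZ gK subvsP.
exists (vquot_hom W W' F).
(* Bijectivity only asks for an inverse function, so [G] is applied to a chosen representative and
   its linearity is never established. *)
exists (fun y => vcls W (G (vrep y))) => [x|y]; last first.
  by rewrite /= vquot_homE // GK vrepK.
(* By [FW], equality modulo [W] can be tested modulo [W'] after applying [F], where [G] cancels. *)
rewrite -[x in RHS]vrepK; apply/eqP; rewrite vcls_eq -FW linearB /= GK.
by rewrite -[x in vquot_hom _ _ _ x]vrepK vquot_homE // vrep_cls.
Qed.

Section Switching.
Set Implicit Arguments.
Unset Strict Implicit.
Variables (R : realType) (D : digraph) (eta : vertex D -> sign).

Definition relabel (u : lvertex D) : lvertex D := (u.1, u.2 (+) eta u.1).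

Lemma relabelK : involutive relabel.
Proof. by case=> i e; rewrite /relabel /= -addbA addbb addbF. Qed.

Lemma relabel_deck u : relabel (deck u) = deck (relabel u).
Proof. by rewrite /relabel /deck /= addNb. Qed.

(** Over an arrow from [i] to [j], the [eta i] added at the source cancels the one in the switched
    sign, leaving the [eta j] added at the target. *)
Lemma larrow_relabel (sigma : signing D) u v :
  larrow (switch eta sigma) (relabel u) (relabel v) = larrow sigma u v.
Proof.
apply: eq_existsb => a /=; rewrite /switch.
case: eqP => //= ->; case: u v => [i e] [j e'] /=.
by case: e e' (eta i) (eta j) (sigma a) => [] [] [] [] [].
Qed.

Definition relabel_path p (t : p.-tuple (lvertex D)) : p.-tuple (lvertex D) :=
  map_tuple relabel t.

Lemma relabel_pathK p : involutive (@relabel_path p).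
Proof. by move=> t; apply: val_inj; rewrite /= (mapK relabelK). Qed.

Lemma relabel_path_deck p (t : p.+1.-tuple (lvertex D)) :
  relabel_path (deck_path t) = deck_path (relabel_path t).
Proof.
apply: val_inj; rewrite /= -!map_comp; apply: eq_map => u.
exact: relabel_deck.
Qed.

Lemma face_relabel p (q : 'I_p.+2) (t : p.+2.-tuple (lvertex D)) :
  face q (relabel_path t) = relabel_path (face q t).
Proof.
by apply: eq_from_tnth => i; rewrite !(tnth_map, tnth_mktuple).
Qed.

Lemma regular_relabel p (t : p.+1.-tuple (lvertex D)) :
  regular (relabel_path t) = regular t.
Proof.
rewrite /regular /= sorted_map; case: (val t) => //= x s.
by apply: eq_path => u v /=; rewrite (inj_eq (inv_inj relabelK)).
Qed.

Lemma allowed_relabel (sigma : signing D) p (t : p.+1.-tuple (lvertex D)) :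
  allowed (switch eta sigma) (relabel_path t) = allowed sigma t.
Proof.
rewrite /allowed /= sorted_map; case: (val t) => //= x s.
by apply: eq_path => u v; exact: larrow_relabel.
Qed.

Definition relabel_regular p (g : regular_path D p) : regular_path D p :=
  exist _ (relabel_path (val g)) (etrans (regular_relabel (val g)) (valP g)).

(** Pullback of coefficients; the relabelling being an involution, this is also the pushforward of
    paths. *)
Definition relabel_chain_fun p (x : chain R D p) : chain R D p :=
  [ffun g => x (relabel_regular g)].

Fact relabel_chain_linear p : linear (@relabel_chain_fun p).
Proof. by move=> a x y; apply/ffunP => g; rewrite !ffunE. Qed.

HB.instance Definition _ p :=
  GRing.isSemilinear.Build R (chain R D p) (chain R D p) _
    (@relabel_chain_fun p)
    (GRing.semilinear_linear (@relabel_chain_linear p)).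

Definition relabel_chain p : 'End(chain R D p) := linfun (@relabel_chain_fun p).

(** Nonregular paths are included, both sides then being zero, because faces of regular paths may be
    nonregular. *)
Lemma relabel_chain_path p (t : p.+1.-tuple (lvertex D)) :
  relabel_chain p (path_chain R t) = path_chain R (relabel_path t).
Proof.
apply/ffunP => g; rewrite lfunE !ffunE /=.
by rewrite (can2_eq (@relabel_pathK _) (@relabel_pathK _)).
Qed.

Lemma chain_pathE p (x : chain R D p) :
  x = \sum_(g : regular_path D p) x g *: path_chain R (val g).
Proof.
apply/ffunP => h; rewrite sum_ffunE (bigD1 h) //= big1 => [|g gh].
  by rewrite !ffunE eqxx addr0 [_ *: _]mulr1.
by rewrite !ffunE (inj_eq val_inj) eq_sym (negPf gh) scaler0.
Qed.

Lemma relabel_chainK p : involutive (relabel_chain p).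
Proof.
move=> x; rewrite (chain_pathE x) !linear_sum; apply: eq_bigr => g _.
by rewrite !linearZ /= !relabel_chain_path relabel_pathK.
Qed.

(** Relabelling acts vertex by vertex, hence commutes with deleting a vertex. *)
Lemma relabel_chain_boundary p (x : chain R D p.+1) :
  relabel_chain p (chain_boundary R D p x) =
  chain_boundary R D p (relabel_chain p.+1 x).
Proof.
rewrite (chain_pathE x) !linear_sum; apply: eq_bigr => g _.
rewrite !linearZ /= relabel_chain_path !chain_boundary_pathE linear_sum.
congr (_ *: _); apply: eq_bigr => q _.
by rewrite linearZ /= relabel_chain_path face_relabel.
Qed.

(** The relabelling commutes with [deck], so it permutes the generating relations and descends to
    signed chains. *)
Lemma relabel_chain_deck p :
  (relabel_chain p @: deck_relations R D p <= deck_relations R D p)%VS.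
Proof.
rewrite limg_span; apply/span_subvP => _ /mapP[_ /imageP[g _ ->] ->].
rewrite linearD /= !relabel_chain_path relabel_path_deck.
by apply: memv_span; apply/imageP; exists (relabel_regular g).
Qed.

Definition relabel_signed p : 'End(signed_chain R D p) :=
  vquot_hom (deck_relations R D p) (deck_relations R D p) (relabel_chain p).

Lemma relabel_signed_cls p (x : chain R D p) :
  relabel_signed p (vcls _ x) = vcls _ (relabel_chain p x).
Proof. by rewrite vquot_homE ?relabel_chain_deck. Qed.

Lemma relabel_signedK p : involutive (relabel_signed p).
Proof.
by move=> x; rewrite -[x]vrepK !relabel_signed_cls relabel_chainK.
Qed.

Lemma relabel_signed_boundary p (x : signed_chain R D p.+1) :
  signed_boundary R D p (relabel_signed p.+1 x) =
  relabel_signed p (signed_boundary R D p x).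
Proof.
rewrite -[x]vrepK relabel_signed_cls !vquot_homE ?chain_boundary_deck //.
  by rewrite relabel_chain_boundary.
exact: relabel_chain_deck.
Qed.

Variable sigma : signing D.

Lemma limg_allowed_chain p :
  (relabel_signed p @: allowed_chain R p sigma)%VS =
  allowed_chain R p (switch eta sigma).
Proof.
rewrite limg_span; apply: eq_span => y; apply/mapP/imageP.
  case=> _ /imageP[t tA ->] ->; exists (relabel_path t).
    by rewrite inE allowed_relabel.
  by rewrite relabel_signed_cls relabel_chain_path.
case=> t tA ->; exists (path_class R (relabel_path t)).
  apply/imageP; exists (relabel_path t) => //.
  by rewrite inE -allowed_relabel relabel_pathK.
by rewrite relabel_signed_cls relabel_chain_path relabel_pathK.
Qed.

Lemma mem_allowed_relabel p x :
  (relabel_signed p x \in allowed_chain R p (switch eta sigma)) =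
  (x \in allowed_chain R p sigma).
Proof.
rewrite -limg_allowed_chain; apply/idP/idP => [/memv_imgP[y yA]|/memv_img->//].
by move/(inv_inj (@relabel_signedK p)) ->.
Qed.

Lemma mem_Omega_relabel p x :
  (relabel_signed p x \in Omega R (switch eta sigma) p) =
  (x \in Omega R sigma p).
Proof.
case: p x => [|p] x /=; first exact: mem_allowed_relabel.
by rewrite !memv_cap -!memv_preim relabel_signed_boundary !mem_allowed_relabel.
Qed.

Lemma mem_cycles_relabel p x :
  (relabel_signed p x \in cycles R (switch eta sigma) p) =
  (x \in cycles R sigma p).
Proof.
case: p x => [|p] x; first exact: mem_Omega_relabel.
rewrite [LHS]memv_cap [RHS]memv_cap mem_Omega_relabel !memv_ker.
rewrite relabel_signed_boundary.
(* An injective linear map kills the boundary of [x] only if that boundary is already zero. *)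
by rewrite -[in RHS](inj_eq (inv_inj (@relabel_signedK p)) _ 0) linear0.
Qed.

Lemma mem_boundaries_relabel p x :
  (relabel_signed p x \in boundaries R (switch eta sigma) p) =
  (x \in boundaries R sigma p).
Proof.
(* In both directions the relabelled filling [z] is a filling for the other signing. *)
apply/memv_imgP/memv_imgP => -[z zO xE]; exists (relabel_signed p.+1 z).
- by rewrite -mem_Omega_relabel relabel_signedK.
- by rewrite relabel_signed_boundary -xE relabel_signedK.
- by rewrite mem_Omega_relabel.
- by rewrite relabel_signed_boundary -xE.
Qed.

End Switching.

Theorem proposition3p12 (R : realType) (D : digraph) (sigma : signing D)
    (eta : vertex D -> sign) (p : nat) :
  exists f : {linear homology R sigma p -> homology R (switch eta sigma) p},
    bijective f.
Proof.
have sK := @relabel_signedK R D eta p.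
exact: (vquot_preim_iso _ _ _ _ _ _ _ _ _ sK sK
  (@mem_cycles_relabel R D eta sigma p)
  (@mem_boundaries_relabel R D eta sigma p)).
Qed.
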